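(* Let $(M,P,g)$ be a Riemannian almost product $\mathcal{W}_3$-manifold, let $\nabla$ be the Levi-Civita connection of $g$ with curvature tensor $R$, and let $\nabla'$ be the RPT-connection on $(M,P,g)$ with torsion $$T(x,y,z)=\tfrac12\{F(x,y,Pz)+F(y,z,Px)+F(z,x,Py)\}$$ and curvature tensor $R'$. Then $R'$ is a Riemannian $P$-tensor if and only if $$R(x,y,z,w)=R'(x,y,z,w)-\tfrac14\,g\bigl(T(x,y),T(z,w)\bigr)+\tfrac1{12}\,\sigma^T(x,y,z,w)$$ for all $x,y,z,w$.
   Context: A Riemannian almost product manifold $(M,P,g)$ is a differentiable manifold $M$ with a $(1,1)$-tensor field $P$ and a Riemannian metric $g$ such that $P^2x=x$, $g(Px,Py)=g(x,y)$; throughout $\mathrm{tr}\,P=0$. Put $F(x,y,z)=g((\nabla_xP)y,z)$. $(M,P,g)$ is a $\mathcal{W}_3$-manifold if $F(x,y,z)+F(y,z,x)+F(z,x,y)=0$ identically. For a linear connection $\nabla'$, $T(x,y)=\nabla'_xy-\nabla'_yx-[x,y]$ and $T(x,y,z)=g(T(x,y),z)$. An RPT-connection is a linear connection $\nabla'$ with $\nabla'P=\nabla'g=0$ whose torsion $T(x,y,z)$ is a 3-form. Thus here $\nabla'$ is given by $g(\nabla'_xy,z)=g(\nabla_xy,z)+\frac12T(x,y,z)$ with the stated $T$. Curvature: $R(x,y)z=\nabla_x\nabla_yz-\nabla_y\nabla_xz-\nabla_{[x,y]}z$, $R(x,y,z,w)=g(R(x,y)z,w)$, and $R'$ is defined by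 the same formulas for $\nabla'$. The 4-form $\sigma^T$ is $\sigma^T(x,y,z,w)=g(T(x,y),T(z,w))+g(T(y,z),T(x,w))+g(T(z,x),T(y,w))$. A $(0,4)$-tensor $L$ is a Riemannian $P$-tensor if $L(x,y,z,w)=-L(y,x,z,w)=-L(x,y,w,z)$, $L(x,y,z,w)+L(y,z,x,w)+L(z,x,y,w)=0$ and $L(x,y,Pz,Pw)=L(x,y,z,w)$ for all $x,y,z,w$. *)

(* Defs.v *)
From HB Require Import structures.
From mathcomp Require Import all_boot all_order all_algebra.
From mathcomp Require Import all_classical all_reals all_analysis.
From mathcomp Require Import ring.

Set Implicit Arguments.
Unset Strict Implicit.
Unset Printing Implicit Defensive.

Import Order.TTheory GRing.Theory Num.Theory.
Import numFieldNormedType.Exports.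

Local Open Scope classical_set_scope.
Local Open Scope ring_scope.

Section SmoothOn.
Context {R : realType} {n : nat}.
Implicit Types (U : set 'rV[R]_n) (f h : 'rV[R]_n -> R).

Definition partial (i : 'I_n) f : 'rV[R]_n -> R :=
  fun x => 'D_(delta_mx 0 i : 'rV[R]_n) f x.

(* Meant for open U only: the derivatives are those of the ambient space. *)
Fixpoint Ck (k : nat) U f : Prop :=
  (forall x, U x -> {for x, continuous f}) /\
  match k with
  | 0 => True
  | k'.+1 => forall i : 'I_n,
      (forall x, U x -> derivable f x (delta_mx 0 i : 'rV[R]_n)) /\
      Ck k' U (partial i f)
  end.

Definition smooth_on U f : Prop := forall k, Ck k U f.

Lemma Ck_cts k U f : Ck k U f -> forall x, U x -> {for x, continuous f}.
Proof. by case: k => [|k] [?]. Qed.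

Lemma CkW k U f : Ck k.+1 U f -> Ck k U f.
Proof.
elim: k f => [|k IH] f [cf Df]; split=> // i.
by have [df /IH] := Df i; split.
Qed.

Lemma eq_Ck k U f h : open U -> (forall x, U x -> f x = h x) ->
  Ck k U f -> Ck k U h.
Proof.
move=> oU; elim: k f h => [|k IH] f h fh [cf Df].
all: have fhn (x : 'rV[R]_n) (Ux : U x) : \forall y \near x, f y = h y
  by apply: filterS (open_nbhs_nbhs (conj oU Ux)) => y /fh.
all: have ch x : U x -> {for x, continuous h}.
1,3: move=> Ux; rewrite /prop_for /continuous_at -(fh x Ux);
  apply: cvg_trans (cf x Ux); apply: near_eq_cvg (fhn x Ux).
all: split=> // i; have [df Cf] := Df i; split.
  by move=> x Ux; refine (@near_eq_derivable _ _ _ f h x _ _ (df x Ux)); exact: fhn.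
apply: IH Cf => x Ux; exact: near_eq_derive (fhn x Ux).
Qed.

Lemma Ck_cst k U (a : R) : Ck k U (fun=> a).
Proof.
have cc (a' : R) (x : 'rV[R]_n) : {for x, continuous (fun=> a' : R)}.
  exact: cst_continuous.
elim: k a => [|k IH] a; first by split.
split=> [//|i].
split=> [x _|].
  exact: (@derivable_cst _ _ R a x).
rewrite (_ : partial i _ = fun=> 0) //.
by apply/funext => x; exact: derive_cst.
Qed.

Lemma CkD k U f h : open U -> Ck k U f -> Ck k U h ->
  Ck k U (fun x => f x + h x).
Proof.
move=> oU; elim: k f h => [|k IH] f h [cf Df] [ch Dh]; split=> //.
1,2: by move=> x Ux; exact: (continuousD (cf x Ux) (ch x Ux)).
move=> i; have [df Cf] := Df i; have [dh Ch] := Dh i; split.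
  by move=> x Ux; apply: derivableD; [exact: df|exact: dh].
apply: eq_Ck (IH _ _ Cf Ch) => // x Ux.
by rewrite /partial -deriveD//; [exact: df|exact: dh].
Qed.

Lemma CkM k U f h : open U -> Ck k U f -> Ck k U h ->
  Ck k U (fun x => f x * h x).
Proof.
move=> oU; elim: k f h => [|k IH] f h Cf0 Ch0;
  have [cf Df] := Cf0; have [ch Dh] := Ch0; split=> //.
1,2: by move=> x Ux; exact: (continuousM (cf x Ux) (ch x Ux)).
move=> i; have [df Cf] := Df i; have [dh Ch] := Dh i; split.
  by move=> x Ux; apply: derivableM; [exact: df|exact: dh].
have := CkD oU (IH _ _ (CkW Cf0) Ch) (IH _ _ (CkW Ch0) Cf).
apply: eq_Ck => // x Ux.
by rewrite /partial deriveM//; [exact: df|exact: dh].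
Qed.

End SmoothOn.

Record chart (R : realType) (n : nat) (M : topologicalType) := Chart {
  cdom : set M;
  cmap : M -> 'rV[R]_n;
  cinv : 'rV[R]_n -> M;
  cdom_open : open cdom;
  cran_open : open (cmap @` cdom);
  cmapK : forall p, cdom p -> cinv (cmap p) = p;
  cmap_continuous : forall p, cdom p -> {for p, continuous cmap};
  cinv_continuous : forall p, cdom p -> {for cmap p, continuous cinv}
}.

Arguments cdom_open {R n M} c : rename.
Arguments cran_open {R n M} c : rename.

Record smoothManifold (R : realType) (n : nat) := SmoothManifold {
  manifold_sort :> topologicalType;
  manifold_hausdorff : hausdorff_space manifold_sort;
  manifold_second_countable : @second_countable manifold_sort;
  atlas : set (chart R n manifold_sort);
  atlas_cover : forall p, exists2 c, atlas c & cdom c p;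
  atlas_compatible : forall c d, atlas c -> atlas d -> forall j : 'I_n,
    smooth_on (cmap c @` (cdom c `&` cdom d))
              (fun u => cmap d (cinv c u) 0 j)
}.

Section SmoothFunctions.
Context {R : realType} {n : nat} (M : smoothManifold R n).

Definition smooth (f : M -> R) : Prop :=
  forall c, atlas c -> smooth_on (cmap c @` cdom c) (f \o cinv c).

Definition smooth_pred : {pred (M -> R)} := fun f => `[< smooth f >].

Record smoothFun := SmoothFun {
  smooth_fun :> M -> R;
  smooth_funP : smooth_fun \in smooth_pred
}.

HB.instance Definition _ := [isSub for smooth_fun].
HB.instance Definition _ := [Choice of smoothFun by <:].

Lemma smooth_subring_closed : subring_closed smooth_pred.
Proof.
have cstP a : (fun=> a) \in smooth_pred.
  by apply/asboolP => c ac k; exact: Ck_cst.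
have mulP f h : f \in smooth_pred -> h \in smooth_pred -> f * h \in smooth_pred.
  move=> /asboolP sf /asboolP sh; apply/asboolP => c ac k.
  exact: (CkM (cran_open c) (sf c ac k) (sh c ac k)).
split=> // [|f h /asboolP sf /asboolP sh]; first exact: cstP.
apply/asboolP => c ac k.
have := CkM (cran_open c) (Ck_cst k _ (-1)) (sh c ac k).
move=> /(CkD (cran_open c) (sf c ac k)).
apply: eq_Ck => [|u _]; first exact: cran_open.
by rewrite mulN1r.
Qed.

HB.instance Definition _ := GRing.SubChoice_isSubComPzRing.Build
  (M -> R) smooth_pred smoothFun smooth_subring_closed.

Lemma smooth_scale_subproof (a : R) (f : smoothFun) :
  (fun p => a * f p) \in smooth_pred.
Proof.
have /asboolP sf := smooth_funP f.
apply/asboolP => c ac k.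
exact: (CkM (cran_open c) (Ck_cst k _ a) (sf c ac k)).
Qed.

Definition smooth_scale a f := SmoothFun (smooth_scale_subproof a f).

Let smooth_scalerA a b f :
  smooth_scale a (smooth_scale b f) = smooth_scale (a * b) f.
Proof. by apply/val_inj/funext => p /=; rewrite mulrA. Qed.

Let smooth_scale1r : left_id 1 smooth_scale.
Proof. by move=> f; apply/val_inj/funext => p /=; rewrite mul1r. Qed.

Let smooth_scalerDr : right_distributive smooth_scale +%R.
Proof. by move=> a f h; apply/val_inj/funext => p /=; exact: mulrDr. Qed.

Let smooth_scalerDl f : {morph smooth_scale^~ f : a b / a + b}.
Proof. by move=> a b; apply/val_inj/funext => p /=; exact: mulrDl. Qed.

HB.instance Definition _ := GRing.Zmodule_isLmodule.Build R smoothFun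
  smooth_scalerA smooth_scale1r smooth_scalerDr smooth_scalerDl.

Lemma smooth_scalerAl (a : R) (f h : smoothFun) : a *: (f * h) = a *: f * h.
Proof. by apply/val_inj/funext => p /=; exact: mulrA. Qed.

Lemma smooth_scalerAr (a : R) (f h : smoothFun) : a *: (f * h) = f * (a *: h).
Proof. by rewrite mulrC smooth_scalerAl mulrC. Qed.

End SmoothFunctions.

Section VectorFields.
Context {R : realType} {n : nat} (M : smoothManifold R n).
Local Notation C := (smoothFun M).

Definition derivation (D : C -> C) : Prop :=
  linear D /\ forall f h, D (f * h) = D f * h + f * D h.

Definition derivation_pred : {pred (C -> C^o)} :=
  fun D => `[< derivation D >].

(* On a Hausdorff manifold, smooth vector fields are the same thing as
   R-linear derivations of the ring of smooth functions. *)
Record vectorField := VectorField {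
  vf_act :> C -> C^o;
  vf_actP : vf_act \in derivation_pred
}.

HB.instance Definition _ := [isSub for vf_act].
HB.instance Definition _ := [Choice of vectorField by <:].

Lemma derivation_submod_closed : submod_closed derivation_pred.
Proof.
split=> [|a D E /asboolP[lD mD] /asboolP[lE mE]]; apply/asboolP; split.
- by move=> b f h; rewrite scaler0 addr0.
- by move=> f h; rewrite /= mul0r mulr0 addr0.
- move=> b f h; rewrite !fctE lD lE.
  change (a * (b *: D f + D h) + (b *: E f + E h) =
          b *: (a * D f + E f) + (a * D h + E h)).
  by rewrite mulrDr scalerDr smooth_scalerAr addrACA.
- move=> f h; rewrite !fctE mD mE.
  change (a * (D f * h + f * D h) + (E f * h + f * E h) =
          (a * D f + E f) * h + f * (a * D h + E h)).
  by rewrite !mulrDr mulrDl mulrA (mulrCA a f) addrACA.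
Qed.

HB.instance Definition _ := GRing.SubChoice_isSubLmodule.Build
  C (C -> C^o) derivation_pred vectorField derivation_submod_closed.


Lemma vf_linear (X : vectorField) : linear (X : C -> C).
Proof. by case: X => D /= /asboolP[]. Qed.

Lemma vfM (X : vectorField) (f h : C) : X (f * h) = X f * h + f * X h :> C.
Proof. by case: X => D /= /asboolP[]. Qed.

Lemma vfD (X : vectorField) (f h : C) : X (f + h) = X f + X h :> C.
Proof. by have := vf_linear X 1 f h; rewrite !scale1r. Qed.

Lemma lie_bracket_subproof (X Y : vectorField) :
  (fun f => X (Y f) - Y (X f)) \in derivation_pred.
Proof.
apply/asboolP; split=> [a f h|f h].
  by rewrite !vf_linear scalerBr opprD addrACA.
have key (a b c d e k : C) :
    a + b + (c + d) - (e + c + (b + k)) = a - e + (d - k).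
  ring.
rewrite !vfM !vfD !vfM mulrBl mulrBr.
exact: key.
Qed.

Definition lie_bracket (X Y : vectorField) : vectorField :=
  VectorField (lie_bracket_subproof X Y).

End VectorFields.

Section Tensors.
Context {R : realType} {n : nat} {M : smoothManifold R n}.
Local Notation C := (smoothFun M).
Local Notation V := (vectorField M).

(* The value x_p of x at p, as a derivation at p. *)
Definition tangent_vec (p : M) (x : V) : C -> R := fun f => (x f : C) p.

Definition tensorial (f : V -> C) : Prop :=
  forall (a : C) (x y : V), f (a *: x + y) = a * f x + f y.

Definition is_tensor3 (L : V -> V -> V -> C) : Prop :=
  [/\ forall y z, tensorial (fun x => L x y z),
      forall x z, tensorial (fun y => L x y z) &
      forall x y, tensorial (fun z => L x y z)].

Definition is_tensor4 (L : V -> V -> V -> V -> C) : Prop :=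
  [/\ forall y z w, tensorial (fun x => L x y z w),
      forall x z w, tensorial (fun y => L x y z w),
      forall x y w, tensorial (fun z => L x y z w) &
      forall x y z, tensorial (fun w => L x y z w)].

Definition is_3form (L : V -> V -> V -> C) : Prop :=
  [/\ is_tensor3 L,
      forall x y z, L x y z = - L y x z &
      forall x y z, L x y z = - L x z y].

Definition riemannian_metric (g : V -> V -> C) : Prop :=
  [/\ forall y, tensorial (fun x => g x y),
      forall x y, g x y = g y x &
      forall p x, (exists f, tangent_vec p x f != 0) -> 0 < g x x p].

(* The values E_i(p) form a basis of the tangent space T_pM (every tangent
   vector at p is the value at p of a global vector field). *)
Definition frame_at (p : M) (E : 'I_n -> V) : Prop :=
  forall x, exists! c : 'rV[R]_n, forall f,
    tangent_vec p x f = \sum_i c 0 i * tangent_vec p (E i) f.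

Definition traceless (P : V -> V) : Prop :=
  forall p (E : 'I_n -> V) (A : 'M[R]_n), frame_at p E ->
    (forall i f, tangent_vec p (P (E i)) f =
                 \sum_j A i j * tangent_vec p (E j) f) ->
    \tr A = 0.

Definition riemannian_almost_product (P : V -> V) (g : V -> V -> C) : Prop :=
  [/\ riemannian_metric g, linear P, forall x, P (P x) = x,
      forall x y, g (P x) (P y) = g x y & traceless P].

Definition linear_connection (D : V -> V -> V) : Prop :=
  [/\ forall (a : C) (x y z : V), D (a *: x + y) z = a *: D x z + D y z,
      forall x y z : V, D x (y + z) = D x y + D x z &
      forall (a : C) (x y : V), D x (a *: y) = (x a : C) *: y + a *: D x y].

Definition torsion (D : V -> V -> V) (x y : V) : V :=
  D x y - D y x - lie_bracket x y.

Definition curvature (D : V -> V -> V) (x y z : V) : V :=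
  D x (D y z) - D y (D x z) - D (lie_bracket x y) z.

Definition torsion3 (g : V -> V -> C) (D : V -> V -> V) (x y z : V) : C :=
  g (torsion D x y) z.

Definition curvature4 (g : V -> V -> C) (D : V -> V -> V) (x y z w : V) : C :=
  g (curvature D x y z) w.

Definition parallel_metric (g : V -> V -> C) (D : V -> V -> V) : Prop :=
  forall x y z : V, x (g y z) = g (D x y) z + g y (D x z) :> C.

Definition cov_endo (D : V -> V -> V) (P : V -> V) (x y : V) : V :=
  D x (P y) - P (D x y).

Definition levi_civita (g : V -> V -> C) (D : V -> V -> V) : Prop :=
  [/\ linear_connection D, parallel_metric g D & forall x y, torsion D x y = 0].

Definition Ftensor (P : V -> V) (g : V -> V -> C) (D : V -> V -> V)
    (x y z : V) : C :=
  g (cov_endo D P x y) z.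

(* D is the Levi-Civita connection of g. *)
Definition W3 (P : V -> V) (g : V -> V -> C) (D : V -> V -> V) : Prop :=
  let F := Ftensor P g D in
  forall x y z, F x y z + F y z x + F z x y = 0.

Definition RPT_connection (P : V -> V) (g : V -> V -> C) (D : V -> V -> V) :
    Prop :=
  [/\ linear_connection D, forall x y, cov_endo D P x y = 0,
      parallel_metric g D & is_3form (torsion3 g D)].

Definition sigmaT (g : V -> V -> C) (T : V -> V -> V) (x y z w : V) : C :=
  g (T x y) (T z w) + g (T y z) (T x w) + g (T z x) (T y w).

Definition riemannian_P_tensor (P : V -> V) (L : V -> V -> V -> V -> C) :
    Prop :=
  is_tensor4 L /\
  [/\ forall x y z w, L x y z w = - L y x z w,
      forall x y z w, L x y z w = - L x y w z,
      forall x y z w, L x y z w + L y z x w + L z x y w = 0 &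
      forall x y z w, L x y (P z) (P w) = L x y z w].

End Tensors.

(* Main.v *)
(* Let S = nabla' - nabla. Both connections being metric and the torsion a 3-form,
   S = T/2. Writing A(x,y,z,w) = g((nabla'_x S)(y,z),w), which is alternating in
   y, z, w, one gets
     R(x,y,z,w) = R'(x,y,z,w) - A(x,y,z,w) + A(y,x,z,w)
                  - sigma^T(x,y,z,w)/4 - g(T(x,y),T(z,w))/4.
   Since R satisfies the first Bianchi identity, R' does so if and only if the
   cyclic sum of A over x, y, z is -sigma^T/2. Using this for each triple among
   x, y, z, w forces A = -sigma^T/6, and hence the stated formula; conversely the
   sigma^T terms of the formula cancel in the cyclic sum. The other properties of
   a Riemannian P-tensor hold for any metric connection with nabla'P = 0. *)

Require Import Defs.
From mathcomp Require Import all_boot all_order all_algebra.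
From mathcomp Require Import all_classical all_reals all_analysis.
From mathcomp Require Import ring lra.
Import GRing.Theory.
Local Open Scope ring_scope.

(** * Vector fields as derivations, the Lie bracket and tensorial maps *)

Section VectorFieldAlgebra.
Context {R : realType} {n : nat} {M : smoothManifold R n}.
Local Notation C := (smoothFun M).
Local Notation V := (vectorField M).
Implicit Types (x y z w : V) (a f : C).

(** Passing to values at a point replaces the ring of smooth functions by an ordered field, where
    [lra] can solve linear systems. *)
Lemma smoothFun_eqP f f' : (forall p, f p = f' p) -> f = f'.
Proof. by move=> e; apply/val_inj/funext => p; exact: e. Qed.

Lemma smoothFun_congr f f' : f = f' -> forall p, f p = f' p.
Proof. by move=> ->. Qed.

Lemma smoothFunDE f f' p : (f + f') p = f p + f' p. Proof. by []. Qed.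

Lemma smoothFunNE f p : (- f) p = - f p. Proof. by []. Qed.

Lemma smoothFunZE (k : R) f p : (k *: f) p = k * f p. Proof. by []. Qed.

Lemma smoothFun0E p : (0 : C) p = 0. Proof. by []. Qed.

Definition smoothFunE := (smoothFunDE, smoothFunNE, smoothFunZE, smoothFun0E).

(** Evaluation on functions turns identities of vector fields into identities in a commutative ring,
    within reach of [ring]. *)
Lemma vectorField_eqP x y : (forall f, x f = y f :> C) -> x = y.
Proof. by move=> e; apply/val_inj/funext => f; exact: e. Qed.

Lemma vfDE x y f : (x + y) f = x f + y f :> C. Proof. by []. Qed.

Lemma vf0E f : (0 : V) f = 0 :> C. Proof. by []. Qed.

Lemma vfNE x f : (- x) f = - x f :> C. Proof. by []. Qed.

Lemma vfZE a x f : (a *: x) f = a * x f :> C. Proof. by []. Qed.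

Lemma lie_bracketE x y f : lie_bracket x y f = x (y f) - y (x f) :> C.
Proof. by []. Qed.

Definition vfE := (vfDE, vfNE, vfZE, lie_bracketE).

Lemma vfN x f : x (- f) = - x f :> C.
Proof.
have x0 : x 0 = 0 :> C.
  by apply: (@addIr _ (x 0 : C)); rewrite -vfD !add0r.
by apply: (@addIr _ (x f : C)); rewrite -vfD !addNr.
Qed.

Lemma lie_bracketC x y : lie_bracket x y = - lie_bracket y x.
Proof. by apply: vectorField_eqP => f; rewrite !vfE; ring. Qed.

Lemma lie_bracketPl a x x' y :
  lie_bracket (a *: x + x') y =
    a *: lie_bracket x y - (y a : C) *: x + lie_bracket x' y.
Proof.
apply: vectorField_eqP => f; rewrite !vfE vfD vfM; ring.
Qed.

Lemma jacobi x y z :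
  lie_bracket x (lie_bracket y z) + lie_bracket y (lie_bracket z x)
    + lie_bracket z (lie_bracket x y) = 0.
Proof.
apply: vectorField_eqP => f; rewrite vf0E !vfE !vfD !vfN; ring.
Qed.

Lemma tensorialD (L : V -> C) x y : tensorial L -> L (x + y) = L x + L y.
Proof. by move=> tL; have := tL 1 x y; rewrite scale1r mul1r. Qed.

Lemma tensorialN (L : V -> C) x : tensorial L -> L (- x) = - L x.
Proof.
move=> tL; have L0 : L 0 = 0.
  by apply: (@addIr _ (L 0)); rewrite -tensorialD // !add0r.
by apply: (@addIr _ (L x)); rewrite -tensorialD // !addNr.
Qed.

Lemma tensorial_opp (L L' : V -> C) :
  (forall x, L x = - L' x) -> tensorial L' -> tensorial L.
Proof. by move=> e tL' a x y; rewrite !e tL'; ring. Qed.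

End VectorFieldAlgebra.

(** * Linear connections and their curvature *)

Section Connections.
Context {R : realType} {n : nat} {M : smoothManifold R n}.
Local Notation C := (smoothFun M).
Local Notation V := (vectorField M).
Context {D : V -> V -> V} (hD : linear_connection D).
Implicit Types (x y z w : V) (a : C).

Lemma connectionDl x y z : D (x + y) z = D x z + D y z.
Proof. by case: hD => h _ _; have := h 1 x y z; rewrite !scale1r. Qed.

Lemma connection0l z : D 0 z = 0.
Proof. by apply: (@addIr _ (D 0 z)); rewrite -connectionDl !add0r. Qed.

Lemma connectionNl x z : D (- x) z = - D x z.
Proof.
by apply: (@addIr _ (D x z)); rewrite -connectionDl !addNr connection0l.
Qed.

Lemma connectionDr x y z : D x (y + z) = D x y + D x z.
Proof. by case: hD. Qed.

Lemma connectionNr x z : D x (- z) = - D x z.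
Proof.
have D0 : D x 0 = 0.
  by apply: (@addIr _ (D x 0)); rewrite -connectionDr !add0r.
by apply: (@addIr _ (D x z)); rewrite -connectionDr !addNr.
Qed.

Lemma connectionZl a x z : D (a *: x) z = a *: D x z.
Proof.
by case: hD => h _ _; have := h a x 0 z; rewrite addr0 connection0l addr0.
Qed.

Lemma connectionZr a x y : D x (a *: y) = (x a : C) *: y + a *: D x y.
Proof. by case: hD. Qed.

Lemma curvatureC x y z : curvature D x y z = - curvature D y x z.
Proof.
rewrite /curvature (lie_bracketC y) connectionNl.
by apply: vectorField_eqP => f; rewrite !vfE; ring.
Qed.

(** The derivative of the coefficient in [D y (a *: D x z)] cancels against the extra term of
    [lie_bracketPl]. *)
Lemma curvaturePl a x x' y z :
  curvature D (a *: x + x') y z = a *: curvature D x y z + curvature D x' y z.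
Proof.
rewrite /curvature lie_bracketPl !connectionDl !connectionZl connectionNl.
rewrite connectionZl connectionDr connectionZr.
by apply: vectorField_eqP => f; rewrite !vfE; ring.
Qed.

(** Mixed first-order terms cancel in pairs, and the second derivatives of [a] cancel against
    [lie_bracket x y] applied to [a]. *)
Lemma curvaturePr a x y z z' :
  curvature D x y (a *: z + z') = a *: curvature D x y z + curvature D x y z'.
Proof.
rewrite /curvature !(connectionDr, connectionZr).
by apply: vectorField_eqP => f; rewrite !vfE; ring.
Qed.

(** Vanishing torsion lets the arguments of [D] be exchanged at the cost of a bracket; second
    derivatives then cancel and the double brackets left over form the Jacobi sum. *)
Lemma curvature_bianchi x y z : (forall u v, torsion D u v = 0) ->
  curvature D x y z + curvature D y z x + curvature D z x y = 0.
Proof.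
move=> tD.
have DC u v : D u v = D v u + lie_bracket u v.
  have /eqP := tD u v; rewrite /torsion -addrA -opprD subr_eq0 => /eqP ->.
  by [].
rewrite /curvature -(jacobi x y z).
rewrite (DC (lie_bracket x y)) (DC (lie_bracket y z)) (DC (lie_bracket z x)).
rewrite (DC x z) (DC y x) (DC z y) !connectionDr.
rewrite (lie_bracketC (lie_bracket x y)) (lie_bracketC (lie_bracket y z)).
rewrite (lie_bracketC (lie_bracket z x)).
rewrite (lie_bracketC x z) (lie_bracketC y x) (lie_bracketC z y) !connectionNr.
by apply: vectorField_eqP => f; rewrite !(vfDE, vfNE); ring.
Qed.

End Connections.

(** This is (D_x S)(y,z), the covariant derivative of [S] with respect to [D]. *)
Definition cov_diff {R : realType} {n : nat} {M : smoothManifold R n}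
    (D S : vectorField M -> vectorField M -> vectorField M) x y z :=
  D x (S y z) - S (D x y) z - S y (D x z).

(** Expand with [D0 = D - S]. Completing the derivatives of [S] to [cov_diff] leaves [D x y - D y x]
    in the first slot of [S], which joins the bracket to form the torsion. *)
Lemma curvature_change {R : realType} {n : nat} {M : smoothManifold R n}
    (D D0 S : vectorField M -> vectorField M -> vectorField M) x y z :
  linear_connection D -> linear_connection D0 ->
  (forall u v, S u v = D u v - D0 u v) ->
  curvature D0 x y z = curvature D x y z
    - cov_diff D S x y z + cov_diff D S y x z
    + S x (S y z) - S y (S x z) - S (torsion D x y) z.
Proof.
move=> hD hD0 SE.
have hS u v : D0 u v = D u v - S u v by rewrite SE subKr.
have SDl u u' v : S (u + u') v = S u v + S u' v.
  by rewrite !SE (connectionDl hD) (connectionDl hD0) opprD addrACA.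
have SNl u v : S (- u) v = - S u v.
  by rewrite !SE (connectionNl hD) (connectionNl hD0) opprB opprK addrC.
have SDr u v v' : S u (v + v') = S u v + S u v'.
  by rewrite !SE (connectionDr hD) (connectionDr hD0) opprD addrACA.
have SNr u v : S u (- v) = - S u v.
  by rewrite !SE (connectionNr hD) (connectionNr hD0) opprB opprK addrC.
rewrite /curvature /cov_diff /torsion !hS.
rewrite !(connectionDr hD, connectionNr hD, SDl, SNl, SDr, SNr).
by apply: vectorField_eqP => f; rewrite !(vfDE, vfNE); ring.
Qed.

(** Reduces an identity that holds modulo a known equation to one that [ring] can check. *)
Lemma eq_from_subr {V : zmodType} {a b c d : V} :
  a = b -> c - d = a - b -> c = d.
Proof. by move=> ->; rewrite subrr => /subr0_eq. Qed.

(** * The metric and the symmetries of the curvature tensor *)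

Section Metric.
Context {R : realType} {n : nat} {M : smoothManifold R n}.
Local Notation C := (smoothFun M).
Local Notation V := (vectorField M).
Context {g : V -> V -> C} (hg : riemannian_metric g).
Implicit Types (x y z w : V) (a : C).

Lemma metricC x y : g x y = g y x. Proof. by case: hg. Qed.

Lemma metricDl x y z : g (x + y) z = g x z + g y z.
Proof. by case: hg => gl _ _; rewrite (tensorialD (g^~ z)). Qed.

Lemma metricNl x z : g (- x) z = - g x z.
Proof. by case: hg => gl _ _; rewrite (tensorialN (g^~ z)). Qed.

Lemma metricDr x y z : g x (y + z) = g x y + g x z.
Proof. by rewrite metricC metricDl !(metricC x). Qed.

(** Take [z = x]: positivity fails at any point where [x] does not vanish. *)
Lemma metric_nondegenerate x : (forall z, g x z = 0) -> x = 0.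
Proof.
case: hg => _ _ gpos gx0; apply: vectorField_eqP => f.
apply: smoothFun_eqP => p; apply: contrapT => /eqP xfp.
have := gpos p x (ex_intro _ f xfp); rewrite gx0.
by change (0 < 0 :> R -> False); rewrite Order.POrderTheory.ltxx.
Qed.

Lemma curvature4C D x y z w : linear_connection D ->
  curvature4 g D x y z w = - curvature4 g D y x z w.
Proof. by move=> hD; rewrite /curvature4 curvatureC // metricNl. Qed.

(** Compute [lie_bracket x y] on [g z w] both directly and as a commutator: the products of first
    derivatives cancel, leaving the two curvature terms with sum zero. *)
Lemma curvature4_metric D x y z w : parallel_metric g D ->
  curvature4 g D x y z w = - curvature4 g D x y w z.
Proof.
move=> par; have := lie_bracketE x y (g z w).
rewrite !par !vfD !par /curvature4 /curvature !(metricDl, metricNl).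
rewrite !(metricC z) !(metricC (D y z)) !(metricC (D x z)) => e.
by apply: (eq_from_subr (esym e)); ring.
Qed.

Lemma curvature4_tensor D : linear_connection D ->
  is_tensor4 (curvature4 g D).
Proof.
case: hg => gl _ _ hD.
have gP a x y z : g (a *: x + y) z = a * g x z + g y z by exact: gl.
have Tx y z w : tensorial (fun x => curvature4 g D x y z w).
  by move=> a x x'; rewrite /curvature4 curvaturePl.
split=> // [x z w|x y w|x y z].
- by apply: tensorial_opp (Tx x z w) => y; exact: curvature4C.
- by move=> a z z'; rewrite /curvature4 curvaturePr.
- by move=> a w w'; rewrite /curvature4 !(metricC (curvature D x y z)) gP.
Qed.

End Metric.

(* The cyclic sums over the four triples of arguments are four linear equations
   in A x y z w, A y x z w, A z x y w and A w x y z, whose solution is unique. *)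
Lemma alternating_of_cyclic_sum (K : realFieldType) (X : Type)
    (A q : X -> X -> X -> X -> K) :
  (forall x y z w, A x y z w = - A x z y w) ->
  (forall x y z w, A x y z w = - A x y w z) ->
  (forall x y z w, q x y z w = - q y x z w) ->
  (forall x y z w, q x y z w = q z w x y) ->
  (forall x y z w, A x y z w + A y z x w + A z x y w =
     - 2 * (q x y z w + q y z x w + q z x y w)) ->
  forall x y z w,
    3 * A x y z w = - 2 * (q x y z w + q y z x w + q z x y w) /\
    A y x z w = - A x y z w.
Proof.
move=> A12 A23 q12 qC cyc x y z w.
have q34 u v s t : q u v s t = - q u v t s by rewrite qC q12 qC.
have rotA u v s t : A u v s t = A u s t v by rewrite A12 A23 opprK.
have c1 := cyc x y z w; have c2 := cyc x y w z.
have c3 := cyc x z w y; have c4 := cyc y z w x.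
rewrite (A12 y z) in c1.
rewrite (A23 x y w) (rotA y w) in c2.
rewrite -(rotA x y) (rotA z w) (A23 w x z) in c3.
rewrite -(rotA y x) (rotA z w) (A12 z y) -(rotA w x) in c4.
(* The cyclic sum of [q] is totally skew: it becomes that of [c1], with a minus sign in [c2] and
   [c4] and a plus sign in [c3]. *)
rewrite (q34 x y w) (qC y w) (q12 x z) (qC w x) (q34 y z w) in c2.
rewrite (q12 x z) (q34 z x w) (qC z w) (qC w x) (q12 z y) (q34 y z w) in c3.
rewrite (q34 y z w) (qC z w) (q12 y x) (qC w y) (q34 z x w) in c4.
split; lra.
Qed.

(** * Metric connections with totally skew torsion *)

Section SkewTorsion.
Context {R : realType} {n : nat} {M : smoothManifold R n}.
Local Notation C := (smoothFun M).
Local Notation V := (vectorField M).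
Context {g : V -> V -> C} {D0 D S : V -> V -> V}.
Context (hg : riemannian_metric g).
Context (lc : levi_civita g D0).
Context (hD : linear_connection D).
Context (par : parallel_metric g D).
Context (skew : is_3form (torsion3 g D)).
Context (SE : forall x y, S x y = D x y - D0 x y).
Implicit Types (x y z w : V).

Local Notation A x y z w := (g (cov_diff D S x y z) w).
Local Notation q x y z w := (g (S x y) (S z w)).

(** Subtract the metric identities of [D] and [D0]. *)
Let S23 x y z : g (S x y) z = - g (S x z) y.
Proof.
case: lc => _ par0 _.
have := par x y z; rewrite par0 !(metricC hg y) => e.
rewrite !SE !(metricDl hg) !(metricNl hg).
by apply: (eq_from_subr (esym e)); ring.
Qed.

Let torsionE x y : torsion D x y = S x y - S y x.
Proof.
case: lc => _ _ t0; rewrite -[LHS]subr0 -(t0 x y) /torsion !SE.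
by apply: vectorField_eqP => f; rewrite !(vfDE, vfNE); ring.
Qed.

(** Skewness of the torsion in its last two arguments, combined with [S23], gives [S13]; the
    transposition (12) is the product (23)(13)(23). *)
Let S12 x y : S x y = - S y x.
Proof.
apply/eqP; rewrite -subr_eq0 opprK; apply/eqP.
apply: (metric_nondegenerate hg) => z; rewrite (metricDl hg).
have S13 u v t : g (S u v) t = - g (S t v) u.
  case: skew => _ _ /(_ v u t).
  rewrite /torsion3 !torsionE !(metricDl hg, metricNl hg) (S23 v t) => e.
  by apply: (eq_from_subr (esym e)); ring.
by rewrite S23 S13 S23 !opprK addNr.
Qed.

Lemma torsion_half x y : torsion D x y = S x y + S x y.
Proof. by rewrite torsionE (S12 y) opprK. Qed.

(** In [curvature_change] the torsion is twice [S], and skewness of [S] moves its outer occurrence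
    across [g], so every quadratic term becomes a [q]. *)
Lemma curvature4_skew_torsion x y z w :
  curvature4 g D0 x y z w = curvature4 g D x y z w - A x y z w + A y x z w
    - q y z x w - q z x y w - (q x y z w + q x y z w).
Proof.
case: (lc) => hD0 _ _.
rewrite /curvature4 (curvature_change D D0 S) // torsion_half.
have SDl u v : S (u + u) v = S u v + S u v.
  by rewrite !SE (connectionDl hD) (connectionDl hD0) opprD addrACA.
rewrite SDl !(metricDl hg, metricNl hg).
rewrite (S23 x (S y z)) (S23 y (S x z)) (S12 (S x y)) (metricNl hg) (S23 z).
rewrite (S12 z x) (metricNl hg) (metricC hg (S x y)).
rewrite (metricC hg (S x w)) (metricC hg (S y w)); ring.
Qed.

Let A12 x y z w : A x y z w = - A x z y w.
Proof.
rewrite /cov_diff (S12 z y) (S12 (D x z)) (S12 z (D x y)) (connectionNr hD).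
rewrite !(metricDl hg, metricNl hg); ring.
Qed.

Let A23 x y z w : A x y z w = - A x y w z.
Proof.
(* Differentiate [S23] along [x]. *)
have e := par x (S y z) w; rewrite S23 vfN par in e.
rewrite /cov_diff !(metricDl hg, metricNl hg).
rewrite (S23 (D x y)) (S23 y (D x z)) (S23 y (D x w)).
rewrite !(metricC hg _ (D x _)) in e *.
by apply: (eq_from_subr (esym e)); ring.
Qed.

Let q12 x y z w : q x y z w = - q y x z w.
Proof. by rewrite (S12 x) (metricNl hg). Qed.

Lemma curvature_bianchi_iff :
  (forall x y z w, curvature4 g D x y z w + curvature4 g D y z x w
     + curvature4 g D z x y w = 0) <->
  (forall x y z w, curvature4 g D0 x y z w = curvature4 g D x y z w
     - (4^-1 : R) *: g (torsion D x y) (torsion D z w)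
     + (12^-1 : R) *: sigmaT g (torsion D) x y z w).
Proof.
have bianchi0 x y z w : curvature4 g D0 x y z w + curvature4 g D0 y z x w
    + curvature4 g D0 z x y w = 0.
  case: lc => hD0 _ t0; rewrite -!(metricDl hg) curvature_bianchi //.
  by have := metricDl hg 0 0 w; rewrite addr0 => /eqP; rewrite -subr_eq subrr
    => /eqP.
have gT x y z w : g (torsion D x y) (torsion D z w) =
    q x y z w + q x y z w + (q x y z w + q x y z w).
  by rewrite !torsion_half !(metricDl hg, metricDr hg).
split=> [bianchi x y z w|RE x y z w]; apply: smoothFun_eqP => p.
- have [||||u v s t|] := @alternating_of_cyclic_sum R V
    (fun x y z w => A x y z w p) (fun x y z w => q x y z w p) _ _ _ _ _ x y z w.
  + by move=> u v s t; rewrite A12.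
  + by move=> u v s t; rewrite A23.
  + by move=> u v s t; rewrite q12.
  + by move=> u v s t; rewrite (metricC hg).
  (* Comparing the two Bianchi identities, [A12] makes both families of [A] terms contribute the
     same cyclic sum, and the [q] terms add up to twice theirs. *)
  + have := smoothFun_congr _ _ (bianchi0 u v s t) p.
    have := smoothFun_congr _ _ (bianchi u v s t) p.
    rewrite !curvature4_skew_torsion (A12 v u s) (A12 u s v) (A12 s v u).
    rewrite !smoothFunE; lra.
  move=> A3 Aalt.
  (* With Q the cyclic sum of [q], [sigmaT] is 4Q and A = -2Q/3. So -2A - Q = Q/3, which is where
     1/12 comes from. *)
  rewrite curvature4_skew_torsion /sigmaT !gT !smoothFunE Aalt; lra.
(* The cyclic sum of [g (T x y) (T z w)] is [sigmaT], which is itself cyclically invariant, and -1/4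
   + 3/12 = 0. *)
- have := smoothFun_congr _ _ (bianchi0 x y z w) p.
  rewrite !RE /sigmaT !gT !smoothFunE; lra.
Qed.

End SkewTorsion.

(** A parallel [P] commutes with each [D u], hence with the curvature operator, and [P] is an
    isometry. *)
Lemma curvature4_parallel {R : realType} {n : nat} {M : smoothManifold R n}
    (P : vectorField M -> vectorField M)
    (g : vectorField M -> vectorField M -> smoothFun M)
    (D : vectorField M -> vectorField M -> vectorField M) x y z w :
  linear P -> (forall u v, g (P u) (P v) = g u v) ->
  (forall u v, cov_endo D P u v = 0) ->
  curvature4 g D x y (P z) (P w) = curvature4 g D x y z w.
Proof.
move=> lP gP DP0.
have DP u v : D u (P v) = P (D u v) by exact: subr0_eq (DP0 u v).
have PB u v : P (u - v) = P u - P v.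
  by rewrite addrC -scaleN1r lP scaleN1r addrC.
by rewrite /curvature4 /curvature !DP -!PB gP.
Qed.

Theorem theorem3p1 (R : realType) (n : nat) (M : smoothManifold R n)
    (P : vectorField M -> vectorField M)
    (g : vectorField M -> vectorField M -> smoothFun M)
    (nabla nabla' : vectorField M -> vectorField M -> vectorField M) :
  riemannian_almost_product P g ->
  levi_civita g nabla ->
  W3 P g nabla ->
  RPT_connection P g nabla' ->
  let F := Ftensor P g nabla in
  let T := torsion nabla' in
  let R_ := curvature4 g nabla in
  let R' := curvature4 g nabla' in
  (forall x y z, g (T x y) z =
     (2^-1 : R) *: (F x y (P z) + F y z (P x) + F z x (P y))) ->
  riemannian_P_tensor P R' <->
  (forall x y z w, R_ x y z w =
     R' x y z w - (4^-1 : R) *: g (T x y) (T z w)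
       + (12^-1 : R) *: sigmaT g T x y z w).
Proof.
move=> [hg lP _ gP _] lc _ [hD DP par skew] F T R_ R' _.
pose S x y := nabla' x y - nabla x y.
have bianchi := curvature_bianchi_iff hg lc hD par skew (S := S)
  (fun _ _ => erefl).
split=> [[_ [_ _ b _]]|RE]; first by apply/bianchi.
split; first exact: curvature4_tensor.
split=> [x y z w|x y z w||x y z w].
- exact: curvature4C.
- exact: curvature4_metric.
- exact/bianchi.
- exact: curvature4_parallel.
Qed.
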